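(* Let $\mathcal{A} \in \mathbb{R}^{n \times n \times p}$ be T-positive definite. Consider the Denman--Beavers iteration $$\mathcal{X}_{k+1} = \frac{1}{2}\bigl(\mathcal{X}_k + \mathcal{Y}_k^{-1}\bigr), \qquad \mathcal{Y}_{k+1} = \frac{1}{2}\bigl(\mathcal{Y}_k + \mathcal{X}_k^{-1}\bigr), \qquad k=0,1,2,\dots,$$ with initial values $\mathcal{X}_0 = \mathcal{A}$ and $\mathcal{Y}_0 = \mathcal{I}$. Then: 1. The sequences $\{\mathcal{X}_k\}$ and $\{\mathcal{Y}_k\}$ are well-defined (all iterates remain T-invertible). 2. $\mathcal{X}_k \to \mathcal{A}^{1/2}$ and $\mathcal{Y}_k \to \mathcal{A}^{-1/2}$ as $k \to \infty$. 3. The convergence is at least geometric (linear) in the tensor Frobenius norm: there exist constants $C > 0$ and $r \in (0,1)$ such that for all sufficiently large $k$, $$\bigl\|\mathcal{X}_k - \mathcal{A}^{1/2}\bigr\|_F \leq C\,r^k, \qquad \bigl\|\mathcal{Y}_k - \mathcal{A}^{-1/2}\bigr\|_F \leq C\,r^k.$$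
   Context: For a third-order tensor $\mathcal{A} \in \mathbb{R}^{n \times m \times p}$, its frontal slices are the matrices $A^{(k)} = \mathcal{A}(:,:,k) \in \mathbb{R}^{n\times m}$, $k=1,\dots,p$. T-product: for $\mathcal{A},\mathcal{B} \in \mathbb{R}^{n\times n\times p}$, $\mathcal{A} * \mathcal{B} = \mathrm{fold}(\mathrm{bcirc}(\mathcal{A}) \cdot \mathrm{unfold}(\mathcal{B}))$, where $\mathrm{unfold}(\mathcal{B}) \in \mathbb{R}^{np \times n}$ stacks the frontal slices $B^{(1)},\dots,B^{(p)}$ vertically, $\mathrm{fold}$ is its inverse, and $\mathrm{bcirc}(\mathcal{A}) \in \mathbb{R}^{np\times np}$ is the block-circulant matrix whose first block column is $A^{(1)},\dots,A^{(p)}$. The identity tensor $\mathcal{I}$ has first frontal slice $I_n$ and all other frontal slices zero. $\mathcal{X}$ is T-invertible if there is a tensor $\mathcal{X}^{-1}$ with $\mathcal{X} * \mathcal{X}^{-1} = \mathcal{X}^{-1} * \mathcal{X} = \mathcal{I}$; $\mathcal{X}^{-1}$ is its T-product inverse. Fourier slices: $\hat{\mathcal{A}} = \mathrm{fft}(\mathcal{A}, \text{axis}=3)$ is the discrete Fourier transform of $\mathcal{A}$ along the third mode, with frontal slices $\hat{A}^{(i)} = \sum_{k=1}^p e^{-2\pi \mathrm{i}(i-1)(k-1)/p} A^{(k)}$, $i=1,\dots,p$. The T-product becomes slice-wise matrix multiplication: if $\mathcal{C} = \mathcal{A}*\mathcal{B}$ then $\hat{C}^{(i)} = \hat{A}^{(i)}\hat{B}^{(i)}$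 for all $i$. $\mathcal{A} \in \mathbb{R}^{n\times n\times p}$ is T-positive definite if every Fourier slice $\hat{A}^{(i)}$, $i=1,\dots,p$, is a Hermitian positive definite matrix. The principal T-square root $\mathcal{A}^{1/2}$ of a T-positive definite $\mathcal{A}$ is the unique T-positive definite tensor in $\mathbb{R}^{n\times n\times p}$ with $\mathcal{A}^{1/2} * \mathcal{A}^{1/2} = \mathcal{A}$; equivalently, its Fourier slices are the principal square roots $(\hat{A}^{(i)})^{1/2}$. $\mathcal{A}^{-1/2}$ denotes the T-product inverse of $\mathcal{A}^{1/2}$. The tensor Frobenius norm is $\|\mathcal{A}\|_F = (\sum_{i,j,k} a_{ijk}^2)^{1/2}$. *)

(* Defs.v *)
From HB Require Import structures.
From mathcomp Require Import all_boot all_order all_algebra.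
From mathcomp Require Import complex.
From mathcomp Require Import all_classical all_reals all_analysis.

Set Implicit Arguments.
Unset Strict Implicit.
Unset Printing Implicit Defensive.

Import Order.TTheory GRing.Theory Num.Theory.
Import numFieldNormedType.Exports.

Local Open Scope classical_set_scope.
Local Open Scope ring_scope.
Local Open Scope complex_scope.
Local Open Scope sesquilinear_scope.

(* A tensor is the family of its frontal slices: T k i j is the entry (i,j,k),
   with indices counted from 0. *)
Notation tensor R n m p := {ffun 'I_p -> 'M[R]_(n, m)}.

(* Slices are indexed by 'I_p.+1, so that there is at least one of them and
   i - j below is the subtraction modulo p.+1. *)

Section TProduct.
Context {R : realType} {n p : nat}.
Implicit Types A B X Y : tensor R n n p.+1.

Definition bcirc A : 'M[R]_(\sum_(i < p.+1) n, \sum_(j < p.+1) n) :=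
  \mxblock_(i < p.+1, j < p.+1) A (i - j).

Definition tunfold B : 'M[R]_(\sum_(i < p.+1) n, n) := \mxcol_(i < p.+1) B i.

Definition tfold (M : 'M[R]_(\sum_(i < p.+1) n, n)) : tensor R n n p.+1 :=
  [ffun i => submxcol M i].

Definition tprod A B : tensor R n n p.+1 := tfold (bcirc A *m tunfold B).

Definition tid : tensor R n n p.+1 := [ffun k => if k == 0 then 1%:M else 0].

Definition is_tinv X Y : Prop := tprod X Y = tid /\ tprod Y X = tid.

Definition tinvertible X : Prop := exists Y, is_tinv X Y.

(* Defaults to 0 when X is not T-invertible. *)
Definition tinv X : tensor R n n p.+1 := xget 0 [set Y | is_tinv X Y].

Definition tfnorm A : R :=
  Num.sqrt (\sum_(k < p.+1) \sum_(i < n) \sum_(j < n) A k i j ^+ 2).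

(* Convergence in the finite-dimensional space of tensors, for the library's
   topology on the matrices that are the slices. *)
Definition tcvg (U : nat -> tensor R n n p.+1) (L : tensor R n n p.+1) : Prop :=
  forall k : 'I_p.+1, (fun m => U m k) @ \oo --> L k.

End TProduct.

Section PositiveDefinite.
Context {R : realType} {n p : nat}.
Implicit Types A S : tensor R n n p.+1.

(* exp (- 2 pi i l k / p.+1) in R[i] *)
Definition dft_coef (l k : 'I_p.+1) : R[i] :=
  let t : R := - (2 * pi * (l * k)%N%:R / p.+1%:R) in cos t +i* sin t.

Definition fourier_slice A (l : 'I_p.+1) : 'M[R[i]]_n :=
  \sum_(k < p.+1) dft_coef l k *: map_mx (real_complex R) (A k).

(* In R[i], 0 < z means that z is real and positive. *)
Definition hermitian_posdef (M : 'M[R[i]]_n) : Prop :=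
  M \is hermsymmx /\
  forall x : 'cV[R[i]]_n, x != 0 -> 0 < (x ^t* *m M *m x) 0 0.

Definition tposdef A : Prop :=
  forall l : 'I_p.+1, hermitian_posdef (fourier_slice A l).

Definition is_tsqrt A S : Prop := tposdef S /\ tprod S S = A.

(* The principal square root; defaults to 0 when there is none. *)
Definition tsqrt A : tensor R n n p.+1 := xget 0 [set S | is_tsqrt A S].

End PositiveDefinite.

(* The pair (X_k, Y_k) of the Denman-Beavers iteration; because tinv is total,
   well-definedness is the T-invertibility of every iterate. *)
Fixpoint denman_beavers {R : realType} {n p : nat} (A : tensor R n n p.+1)
    (k : nat) : tensor R n n p.+1 * tensor R n n p.+1 :=
  if k is k'.+1 then
    let: (X, Y) := denman_beavers A k' in
    (2^-1 *: (X + tinv Y), 2^-1 *: (Y + tinv X))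
  else (A, tid).

Definition dbX {R : realType} {n p : nat} (A : tensor R n n p.+1) (k : nat) :
  tensor R n n p.+1 := (denman_beavers A k).1.

Definition dbY {R : realType} {n p : nat} (A : tensor R n n p.+1) (k : nat) :
  tensor R n n p.+1 := (denman_beavers A k).2.

(* Main.v *)
Require Import Defs.
From mathcomp Require Import all_boot all_order all_algebra.
From mathcomp Require Import complex.
From mathcomp Require Import ring lra.
From mathcomp Require Import all_classical all_reals all_analysis.
Import Order.TTheory GRing.Theory Num.Theory.
Import numFieldNormedType.Exports.
Local Open Scope classical_set_scope.
Local Open Scope ring_scope.

(** The T-square root S of A exists and is a T-positive definite tensor, so it has
    a spectral resolution S = sum_a a P_a over finitely many positive reals a,
    where the P_a are real tensors with P_a * P_b = 0 for a <> b, P_a * P_a = P_a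
    and sum_a P_a = I ([tposdef_resolution]). In the commutative algebra spanned
    by the P_a every operation acts on the coefficients separately ([fcalcM],
    [is_tinv_fcalc]). As A = sum_a a^2 P_a, the Denman-Beavers iterates are
    X_k = sum_a x_k(a) P_a and Y_k = sum_a (x_k(a) / a^2) P_a, where x_k(a) is
    Newton's iteration for the square root of a^2 started at a^2
    ([denman_beavers_fcalc]). The scalars x_k(a) are positive, whence the
    invertibility, and |x_k(a) - a| <= (1 + a^2) / 2^k ([heron_le]). Summing
    over the finitely many a gives convergence and the geometric rate 1/2.

    The resolution of a T-positive definite tensor T comes from its Fourier
    slices, which are Hermitian and hence unitarily diagonalizable with positive
    eigenvalues. The projector P_a is L_a(T) for the T-product, where L_a is the
    real Lagrange polynomial that is 1 at a and 0 at the other eigenvalues of all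
    the slices. The algebraic identities can be checked on the slices, because
    the Fourier transform is injective and multiplicative ([fslice_inj],
    [fslice_tprod]). The same resolution, applied to A, gives the existence of
    the square root: if A = sum_a a P_a then sum_a sqrt(a) P_a is one, and it is
    T-positive definite because its slices are squares of invertible Hermitian
    matrices ([posdef_fcalc]). Uniqueness of the root is never needed: the
    argument of the first paragraph applies to any T-positive definite root. *)

(** * The algebra of tensors under the T-product *)

Section TensorAlgebra.
Context {R : realType} {n p : nat}.
Implicit Types A B X Y : tensor R n n p.+1.

(** The T-product is the convolution over the cyclic group of slice indices. *)
Lemma tprodE A B (k : 'I_p.+1) : tprod A B k = \sum_j A (k - j) *m B j.
Proof. by rewrite ffunE mul_mxblock_mxrow mxcolK. Qed.

Lemma tprodA A B X : tprod A (tprod B X) = tprod (tprod A B) X.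
Proof.
apply/ffunP => k; rewrite !tprodE.
under eq_bigr do rewrite tprodE mulmx_sumr.
rewrite exchange_big /=; apply: eq_bigr => i _.
rewrite tprodE mulmx_suml (reindex_inj (addIr i)) /=; apply: eq_bigr => j _.
by rewrite addrK mulmxA opprD addrA addrAC.
Qed.

Lemma tprod1 A : tprod A tid = A.
Proof.
apply/ffunP => k; rewrite tprodE (bigD1 ord0)//= big1 => [|j j0].
  by rewrite ffunE eqxx mulmx1 addr0 subr0.
by rewrite ffunE (negPf j0) mulmx0.
Qed.

Lemma tprod1l A : tprod tid A = A.
Proof.
apply/ffunP => k; rewrite tprodE (bigD1 k)//= big1 => [|j jk].
  by rewrite ffunE subrr eqxx mul1mx addr0.
by rewrite ffunE subr_eq0 eq_sym (negPf jk) mul0mx.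
Qed.

Lemma tprod_suml (I : Type) (r : seq I) (a : I -> R)
    (T : I -> tensor R n n p.+1) B :
  tprod (\sum_(i <- r) a i *: T i) B = \sum_(i <- r) a i *: tprod (T i) B.
Proof.
apply/ffunP => k; rewrite tprodE sum_ffunE.
under [RHS]eq_bigr do rewrite ffunE tprodE scaler_sumr.
rewrite exchange_big /=; apply: eq_bigr => j _.
rewrite sum_ffunE mulmx_suml; apply: eq_bigr => i _.
by rewrite ffunE scalemxAl.
Qed.

Lemma tprod_sumr (I : Type) (r : seq I) (a : I -> R)
    (T : I -> tensor R n n p.+1) B :
  tprod B (\sum_(i <- r) a i *: T i) = \sum_(i <- r) a i *: tprod B (T i).
Proof.
apply/ffunP => k; rewrite tprodE sum_ffunE.
under [RHS]eq_bigr do rewrite ffunE tprodE scaler_sumr.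
rewrite exchange_big /=; apply: eq_bigr => j _.
rewrite sum_ffunE mulmx_sumr; apply: eq_bigr => i _.
by rewrite ffunE scalemxAr.
Qed.

Lemma tinvE X Y : is_tinv X Y -> tinv X = Y.
Proof.
move=> [XY YX]; rewrite /tinv; case: xgetP => [Z _ [XZ ZX]|/(_ Y)[]//].
by rewrite -[Z]tprod1 -XY tprodA ZX tprod1l.
Qed.

End TensorAlgebra.

(** * Functional calculus of a resolution of the identity *)

Section FunctionalCalculus.
Context {R : realType} {n p : nat}.
Implicit Types (s : seq R) (P : R -> tensor R n n p.+1) (f g : R -> R).

(** The tensors P a, for a in s, are complementary projectors: idempotents with
    zero mutual products and with sum the identity. *)
Definition is_resolution s P : Prop :=
  [/\ uniq s, \sum_(a <- s) P a = tid
    & {in s &, forall a b, tprod (P a) (P b) = if a == b then P a else 0}].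

(** The tensor with eigenvalue f a on the range of P a. *)
Definition fcalc s P f : tensor R n n p.+1 := \sum_(a <- s) f a *: P a.

Lemma fcalcM s P f g : is_resolution s P ->
  tprod (fcalc s P f) (fcalc s P g) = fcalc s P (fun a => f a * g a).
Proof.
move=> [su _ PM]; rewrite tprod_suml; apply: eq_big_seq => a sa.
rewrite tprod_sumr (bigD1_seq _ sa su)/= PM// eqxx scalerDr scalerA.
rewrite big_seq_cond big1 ?scaler0 ?addr0// => b /andP[sb ba].
by rewrite PM// eq_sym (negPf ba) scaler0.
Qed.

Lemma eq_fcalc s P f g : {in s, f =1 g} -> fcalc s P f = fcalc s P g.
Proof. by move=> fg; apply: eq_big_seq => a sa; rewrite fg. Qed.

Lemma fcalc1 s P : is_resolution s P -> fcalc s P (fun=> 1) = tid.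
Proof. by move=> [_ <- _]; apply: eq_bigr => a _; rewrite scale1r. Qed.

Lemma fcalcB s P f g : fcalc s P f - fcalc s P g = fcalc s P (fun a => f a - g a).
Proof. by rewrite -sumrB; apply: eq_bigr => a _; rewrite scalerBl. Qed.

Lemma fcalcZD s P c f g :
  c *: (fcalc s P f + fcalc s P g) = fcalc s P (fun a => c * (f a + g a)).
Proof.
rewrite -big_split scaler_sumr /=; apply: eq_bigr => a _.
by rewrite -scalerDl scalerA.
Qed.

Lemma is_tinv_fcalc s P f : is_resolution s P -> {in s, forall a, f a != 0} ->
  is_tinv (fcalc s P f) (fcalc s P (fun a => (f a)^-1)).
Proof.
move=> sP f0; split; rewrite fcalcM// -(fcalc1 _ _ sP); apply: eq_fcalc => a sa.
  by rewrite divff// f0.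
by rewrite mulVf// f0.
Qed.

End FunctionalCalculus.

(** * Unitary diagonalization of positive definite matrices *)

(** Repetitions in s are harmless, since f is a function. *)
Lemma poly_interpolation (F : fieldType) (s : seq F) (f : F -> F) :
  exists q : {poly F}, {in s, forall x, q.[x] = f x}.
Proof.
elim: s => [|a s [q qs]]; first by exists 0.
have [as_|as_] := boolP (a \in s).
  by exists q => x; rewrite inE => /predU1P[->|]; apply: qs.
pose m := \prod_(b <- s) ('X - b%:P).
have ma : m.[a] != 0 by rewrite -/(root m a) root_prod_XsubC.
exists (q + ((f a - q.[a]) / m.[a])%:P * m) => x; rewrite !hornerE inE.
case/predU1P => [->|xs]; first by rewrite divfK// addrC subrK.
have /eqP -> : m.[x] == 0 by rewrite -/(root m x) root_prod_XsubC.
by rewrite mulr0 addr0 qs.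
Qed.

Section DiagonalForm.
Local Open Scope sesquilinear_scope.
Context {C : numClosedFieldType} {n : nat}.
Implicit Types (U M : 'M[C]_n) (e : 'I_n -> C).

(** Hermitian positive definiteness over a closed field with a conjugation. *)
Definition posdefmx M : Prop :=
  M \is hermsymmx /\
  forall x : 'cV[C]_n, x != 0 -> 0 < (x ^t* *m M *m x) 0 0.

(** The matrix with eigenvalues e and, when U is unitary, with the conjugates of
    the rows of U as eigenvectors. *)
Definition diag_form U e : 'M[C]_n :=
  invmx U *m diag_mx (\row_i e i) *m U.

Lemma diag_formM U e1 e2 : U \in unitmx ->
  diag_form U e1 *m diag_form U e2 = diag_form U (fun i => e1 i * e2 i).
Proof.
move=> Uu; rewrite /diag_form !mulmxA mulmxK// -[_ *m _ *m diag_mx _]mulmxA.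
rewrite mulmx_diag; congr (_ *m diag_mx _ *m _).
by apply/rowP => i; rewrite !mxE.
Qed.

Lemma diag_form1 U : U \in unitmx -> diag_form U (fun=> 1) = 1%:M.
Proof.
move=> Uu; rewrite /diag_form.
have -> : \row_(i < n) (1 : C) = const_mx 1 by apply/rowP => i; rewrite !mxE.
by rewrite diag_const_mx mulmx1 mulVmx.
Qed.

Lemma diag_formZD U a e1 e2 :
  diag_form U (fun i => a * e1 i + e2 i) = a *: diag_form U e1 + diag_form U e2.
Proof.
rewrite /diag_form scalemxAl scalemxAr -linearZ -mulmxDl -mulmxDr -raddfD/=.
congr (_ *m diag_mx _ *m _).
by apply/rowP => i; rewrite !mxE.
Qed.

Lemma diag_form0 U : diag_form U (fun=> 0) = 0.
Proof.
rewrite /diag_form.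
have -> : \row_(i < n) (0 : C) = 0 by apply/rowP => i; rewrite !mxE.
by rewrite raddf0 mulmx0 mul0mx.
Qed.

Lemma diag_form_sum U (I : Type) (r : seq I) (a : I -> C) (e : I -> 'I_n -> C) :
  \sum_(j <- r) a j *: diag_form U (e j)
  = diag_form U (fun i => \sum_(j <- r) a j * e j i).
Proof.
elim: r => [|j r IH].
  rewrite big_nil -(diag_form0 U); congr diag_form.
  by apply/funext => i; rewrite big_nil.
rewrite big_cons IH -diag_formZD; congr diag_form.
by apply/funext => i; rewrite big_cons.
Qed.

Lemma diag_form_hermitian U e : U \is unitarymx ->
  (forall i, e i \is Num.real) -> diag_form U e \is hermsymmx.
Proof.
move=> Uu er; apply/is_hermitianmxP; rewrite expr0 scale1r /diag_form.
rewrite invmx_unitary// !trmx_mul !map_mxM trmxCK mulmxA; congr (_ *m _ *m _).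
rewrite tr_diag_mx map_diag_mx; congr diag_mx.
by apply/rowP => i; rewrite !mxE; apply/esym/CrealP.
Qed.

Lemma posdef_diag_form M : posdefmx M ->
  exists U e, [/\ U \is unitarymx, forall i, 0 < e i & M = diag_form U e].
Proof.
move=> [Mh Mpos]; have /hermitian_normalmx/orthomx_spectralP := Mh.
set U := spectralmx M; set d := spectral_diag M => ME.
have Uu : U \is unitarymx := spectral_unitarymx M.
have UV : U *m U^t* = 1%:M by apply/unitarymxP.
exists U, (d 0); split=> //; last first.
  rewrite ME /diag_form; congr (_ *m diag_mx _ *m _).
  by apply/rowP => i; rewrite mxE.
(* d 0 i is the value of the form at the i-th eigenvector *)
move=> i; pose x : 'cV[C]_n := U^t* *m delta_mx i 0.
have xstar : x^t* = delta_mx 0 i *m U.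
  rewrite /x trmx_mul map_mxM trmxCK; congr (_ *m _).
  by rewrite trmx_delta map_delta_mx.
have x0 : x != 0.
  apply/eqP => /(congr1 (mulmx U)); rewrite mulmxA UV mul1mx mulmx0.
  by move=> /matrixP/(_ i 0); rewrite !mxE !eqxx => /eqP; rewrite oner_eq0.
have := Mpos _ x0; rewrite xstar ME invmx_unitary// /x !mulmxA.
rewrite -[_ *m U *m U^t*]mulmxA UV mulmx1 -[_ *m U *m U^t*]mulmxA UV mulmx1.
by rewrite -rowE -colE !mxE eqxx mulr1n.
Qed.

(** The square of an invertible Hermitian matrix is positive definite. *)
Lemma posdef_sqr M : M \is hermsymmx -> M \in unitmx -> posdefmx (M *m M).
Proof.
move=> /is_hermitianmxP; rewrite expr0 scale1r => Mh Mu; split.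
  apply/is_hermitianmxP; rewrite expr0 scale1r trmx_mul map_mxM.
  by rewrite -Mh.
move=> x x0; set y := M *m x.
have y0 : y != 0.
  by apply: contra_neq x0 => y0; rewrite -[x](mulKmx Mu) -/y y0 mulmx0.
have -> : x^t* *m (M *m M) *m x = y^t* *m y.
  by rewrite /y trmx_mul map_mxM -Mh !mulmxA.
clearbody y; rewrite mxE; have [i yi] : exists i, y i 0 != 0.
  by have /matrix0Pn[i [j]] := y0; rewrite ord1; exists i.
under eq_bigr do rewrite !mxE mulrC -normCK.
rewrite (bigD1 i)//=; apply: ltr_pwDl; first by rewrite exprn_gt0 ?normr_gt0.
by apply: sumr_ge0 => j _; rewrite exprn_ge0.
Qed.

Lemma hermitian_sum (I : Type) (r : seq I) (a : I -> C) (Q : I -> 'M[C]_n) :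
  (forall j, a j \is Num.real) -> (forall j, Q j \is hermsymmx) ->
  \sum_(j <- r) a j *: Q j \is hermsymmx.
Proof.
move=> ar Qh; apply/is_hermitianmxP; rewrite expr0 scale1r.
rewrite raddf_sum /= map_mx_sum; apply: eq_bigr => j _.
rewrite linearZ /= map_mxZ; have := Qh j.
move=> /is_hermitianmxP; rewrite expr0 scale1r => <-.
by congr (_ *: _); apply/esym/CrealP.
Qed.

End DiagonalForm.


(** * The discrete Fourier transform of tensors *)

(** The transform is developed over any closed field C with a conjugation, for an
    embedding iota of R into C and a primitive root of unity w whose order is the
    number of slices; the last lemmas also need iota to preserve positivity and to
    have as its image the set of real elements of C. *)
Section Fourier.
Context {R : realType} {C : numClosedFieldType} (iota : {rmorphism R -> C}).
Context {n p : nat} (w : C).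
Implicit Types A B S T X Y : tensor R n n p.+1.

(** The Fourier slices of A, for the root of unity w in C. *)
Definition fslice A (l : 'I_p.+1) : 'M[C]_n :=
  \sum_(k < p.+1) w ^+ (l * k) *: map_mx iota (A k).

Lemma fsliceZD (l : 'I_p.+1) (a : R) A B :
  fslice (a *: A + B) l = iota a *: fslice A l + fslice B l.
Proof.
rewrite /fslice scaler_sumr -big_split /=; apply: eq_bigr => k _.
by rewrite !ffunE map_mxD map_mxZ scalerDr !scalerA mulrC.
Qed.

Lemma fslice0 (l : 'I_p.+1) : fslice 0 l = 0.
Proof. by rewrite /fslice big1// => k _; rewrite ffunE map_mx0 scaler0. Qed.

Lemma fslice_sum (l : 'I_p.+1) (I : Type) (r : seq I) (a : I -> R)
    (T : I -> tensor R n n p.+1) :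
  fslice (\sum_(i <- r) a i *: T i) l = \sum_(i <- r) iota (a i) *: fslice (T i) l.
Proof.
by elim: r => [|i r IH]; rewrite ?big_nil ?fslice0// !big_cons fsliceZD IH.
Qed.

Lemma fslice_tid (l : 'I_p.+1) : fslice tid l = 1%:M.
Proof.
rewrite /fslice (bigD1 ord0)//= big1 => [|k k0]; last first.
  by rewrite ffunE (negPf k0) map_mx0 scaler0.
by rewrite ffunE eqxx map_mx1 muln0 expr0 scale1r addr0.
Qed.

Context (prim_w : p.+1.-primitive_root w).

Lemma prim_exprD (l j k : 'I_p.+1) :
  w ^+ (l * (j + k)%R) = w ^+ (l * j) * w ^+ (l * k).
Proof.
rewrite -exprD -mulnDr !exprM expr_mod//.
by rewrite -exprM mulnC exprM (prim_expr_order prim_w) expr1n.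
Qed.

(** Orthogonality of the characters of the cyclic group. *)
Lemma prim_expr_sum (k : 'I_p.+1) :
  \sum_(l < p.+1) w ^+ (l * k) = if k == 0 then p.+1%:R else 0.
Proof.
under eq_bigr do rewrite mulnC exprM.
case: eqP => [->|/eqP k0].
  by under eq_bigr do rewrite expr0 expr1n; rewrite sumr_const card_ord.
have k1 : w ^+ k - 1 != 0.
  rewrite subr_eq0 -(prim_order_dvd prim_w) gtnNdvd ?ltn_ord// lt0n.
  by rewrite -(inj_eq val_inj) in k0.
apply: (mulfI k1); rewrite mulr0 -subrX1 -exprM mulnC exprM.
by rewrite (prim_expr_order prim_w) expr1n subrr.
Qed.

(** A tensor is determined by its Fourier slices, by the inverse transform. *)
Lemma fslice_inj A B : fslice A =1 fslice B -> A = B.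
Proof.
move=> AB; apply/ffunP => k; apply/matrixP => i j; apply: (fmorph_inj iota).
(* the character at - k selects the slice k *)
have [m mk] : exists m, m + k = 0 by exists (- k); rewrite addNr.
have inv T : \sum_(l < p.+1) w ^+ (l * m) *: fslice T l
    = p.+1%:R *: map_mx iota (T k).
  under eq_bigr do rewrite scaler_sumr.
  rewrite exchange_big /= (bigD1 k)//= [X in _ + X]big1 => [|i' i'k].
    under eq_bigr do rewrite scalerA -prim_exprD.
    by rewrite -scaler_suml prim_expr_sum mk eqxx addr0.
  under eq_bigr do rewrite scalerA -prim_exprD.
  by rewrite -scaler_suml prim_expr_sum -mk (inj_eq (addrI m)) (negPf i'k) scale0r.
have := inv A; under eq_bigr do rewrite AB.
rewrite inv => /matrixP/(_ i j); rewrite !mxE.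
by move=> /mulfI -> //; rewrite pnatr_eq0.
Qed.

(** The transform takes convolutions to slicewise products. *)
Lemma fslice_tprod A B (l : 'I_p.+1) :
  fslice (tprod A B) l = fslice A l *m fslice B l.
Proof.
rewrite {1}/fslice.
under eq_bigr do rewrite tprodE map_mx_sum scaler_sumr.
rewrite exchange_big /= /fslice mulmx_sumr; apply: eq_bigr => j _.
rewrite mulmx_suml (reindex_inj (addIr j)) /=; apply: eq_bigr => k _.
by rewrite addrK map_mxM prim_exprD -scalemxAl -scalemxAr scalerA.
Qed.

(** The value at T of the polynomial q, for the T-product. *)
Definition thorner (q : {poly R}) T : tensor R n n p.+1 :=
  \sum_(i < size q) q`_i *: iter i (tprod T) tid.

Lemma fslice_thorner (q : {poly R}) T l U (e : 'I_n -> R) : U \in unitmx ->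
  fslice T l = diag_form U (iota \o e) ->
  fslice (thorner q T) l = diag_form U (fun i => iota q.[e i]).
Proof.
move=> Uu TE; rewrite fslice_sum.
have iterE k : fslice (iter k (tprod T) tid) l
    = diag_form U (fun i => iota (e i ^+ k)).
  elim: k => [|k IH] /=.
    rewrite fslice_tid -(diag_form1 _ Uu); congr diag_form.
    by apply/funext => i; rewrite rmorph1.
  rewrite fslice_tprod IH TE diag_formM//; congr diag_form.
  by apply/funext => i; rewrite exprS rmorphM.
under eq_bigr do rewrite iterE.
rewrite diag_form_sum; congr diag_form; apply/funext => i.
by rewrite horner_coef rmorph_sum; apply: eq_bigr => k _; rewrite rmorphM.
Qed.

Context (iota_gt0 : forall a, (0 < iota a) = (0 < a)).
Context (iota_real : forall a, iota a \is Num.real).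
Context (iota_onto : forall z, z \is Num.real -> exists a, z = iota a).

(** The projectors are the Lagrange polynomials of the set of all eigenvalues of
    all the Fourier slices, evaluated at T; this is why they are real tensors
    although the eigenvectors of the slices are complex. *)
Lemma spectral_resolution T : (forall l, posdefmx (fslice T l)) ->
  exists s P, [/\ is_resolution s P, {in s, forall a, 0 < a}, T = fcalc s P id
    & forall a l, fslice (P a) l \is hermsymmx].
Proof.
move=> Tpos.
have /choice[Ue UeP] : forall l, exists Ue : 'M[C]_n * ('I_n -> R),
    [/\ Ue.1 \is unitarymx, forall i, 0 < Ue.2 i
      & fslice T l = diag_form Ue.1 (iota \o Ue.2)].
  move=> l; have [U [e [Uy e0 ->]]] := posdef_diag_form _ (Tpos l).
  have /choice[d dE] : forall i, exists a, e i = iota a.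
    by move=> i; apply/iota_onto/gtr0_real.
  exists (U, d); split=> //= [i|]; first by rewrite -iota_gt0 -dE.
  by congr diag_form; apply/funext => i; rewrite dE.
pose U l := (Ue l).1; pose e l := (Ue l).2.
have Uy l : U l \is unitarymx by case: (UeP l).
have Uu l : U l \in unitmx by apply: unitarymx_unit.
have TE l : fslice T l = diag_form (U l) (iota \o e l) by case: (UeP l).
pose s := undup [seq e l i | l <- enum 'I_p.+1, i <- enum 'I_n].
have es l i : e l i \in s by rewrite mem_undup allpairs_f// mem_enum.
have su : uniq s by apply: undup_uniq.
have /choice[L LP] : forall a, exists q : {poly R},
    {in s, forall x, q.[x] = (x == a)%:R}.
  by move=> a; apply: (poly_interpolation _ s (fun x => (x == a)%:R)).
pose P a := thorner (L a) T.
have PE a l : fslice (P a) l = diag_form (U l) (fun i => (e l i == a)%:R).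
  rewrite (fslice_thorner _ _ _ _ _ (Uu l) (TE l)); congr diag_form.
  by apply/funext => i; rewrite LP// rmorph_nat.
have calcE (f : R -> R) l : fslice (fcalc s P f) l
    = diag_form (U l) (fun i => iota (f (e l i))).
  rewrite fslice_sum; under eq_bigr do rewrite PE.
  rewrite diag_form_sum; congr diag_form; apply/funext => i.
  rewrite (bigD1_seq _ (es l i) su)/= eqxx mulr1 big1 ?addr0// => a.
  by rewrite eq_sym => /negPf ->; rewrite mulr0.
exists s, P; split.
- split=> //.
  + apply: fslice_inj => l; rewrite fslice_tid -(diag_form1 _ (Uu l)).
    have -> : \sum_(a <- s) P a = fcalc s P (fun=> 1).
      by apply: eq_bigr => a _; rewrite scale1r.
    by rewrite calcE; congr diag_form; apply/funext => i; rewrite rmorph1.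
  + move=> a b _ _; apply: fslice_inj => l.
    rewrite fslice_tprod !PE diag_formM//.
    have [<-|ab] := eqVneq a b.
      rewrite PE; congr diag_form; apply/funext => i.
      by case: eqP; rewrite ?mulr1 ?mulr0.
    rewrite fslice0 -(diag_form0 (U l)); congr diag_form; apply/funext => i.
    by have [->|] := eqVneq (e l i) a; rewrite ?(negPf ab) ?mulr0 ?mul0r.
- move=> a; rewrite mem_undup => /allpairsP[[l i] [_ _ ->]] /=.
  by case: (UeP l) => _ + _; apply.
- by apply: fslice_inj => l; rewrite calcE TE.
- by move=> a l; rewrite PE; apply: diag_form_hermitian => // i; apply: realn.
Qed.

(** For positive f the slices are squares of those of the calculus of sqrt f,
    which are Hermitian and invertible. *)
Lemma posdef_fcalc s P f :
  is_resolution s P -> (forall a l, fslice (P a) l \is hermsymmx) ->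
  {in s, forall a, 0 < f a} -> forall l, posdefmx (fslice (fcalc s P f) l).
Proof.
move=> sP Ph f0 l.
pose T := fcalc s P (fun a => Num.sqrt (f a)).
have -> : fcalc s P f = tprod T T.
  rewrite fcalcM//; apply: eq_fcalc => a sa.
  by rewrite -expr2 sqr_sqrtr// ltW ?f0.
rewrite fslice_tprod; apply: posdef_sqr.
  by rewrite fslice_sum; apply: hermitian_sum.
have [TV _] : is_tinv T (fcalc s P (fun a => (Num.sqrt (f a))^-1)).
  by apply: is_tinv_fcalc => // a sa; rewrite gt_eqF ?sqrtr_gt0 ?f0.
have := congr1 (fun X => fslice X l) TV.
by rewrite fslice_tprod fslice_tid => /mulmx1_unit[].
Qed.

Lemma posdef_sqrt_exists A : (forall l, posdefmx (fslice A l)) ->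
  exists2 S, forall l, posdefmx (fslice S l) & tprod S S = A.
Proof.
move=> /spectral_resolution[s [P [sP s0 -> Ph]]].
exists (fcalc s P Num.sqrt).
  by apply: posdef_fcalc => // a /s0; rewrite sqrtr_gt0.
by rewrite fcalcM//; apply: eq_fcalc => a /s0 a0; rewrite -expr2 sqr_sqrtr// ltW.
Qed.

End Fourier.

(** * Positive definite tensors and their square roots *)

Section PositiveDefinite.
Local Open Scope complex_scope.
Context {R : realType} {n p : nat}.
Implicit Types A S : tensor R n n p.+1.

(** The root of unity exp (- 2 pi i / N). *)
Definition dft_root (N : nat) : R[i] :=
  let t : R := - (2 * pi / N%:R) in cos t +i* sin t.

Lemma cis_exp (t : R) (m : nat) :
  (cos t +i* sin t) ^+ m = cos (t * m%:R) +i* sin (t * m%:R).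
Proof.
elim: m => [|m IH]; first by rewrite mulr0 cos0 sin0.
rewrite exprS IH -natr1 mulrDr mulr1 cosD sinD.
by simpc; congr (_ +i* _); ring.
Qed.

Lemma dft_root_primitive (N : nat) : (0 < N)%N -> N.-primitive_root (dft_root N).
Proof.
move=> N0; apply/andP; split=> //; apply/forallP => -[m mN].
have N0' : (0 : R) < N%:R by rewrite ltr0n.
rewrite unity_rootE /dft_root cis_exp /=.
have [-> | mN'] := eqVneq m.+1 N.
  have -> : - (2 * pi / N%:R) * N%:R = - (pi *+ 2) :> R.
    by rewrite mulNr divfK ?gt_eqF// mulr_natl.
  by rewrite cosN sinN cos2pi sin2pi oppr0 !eqxx.
rewrite eqbF_neg; apply/negP => /eqP[+ _].
set x : R := pi * (m.+1%:R / N%:R).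
have -> : - (2 * pi / N%:R) * m.+1%:R = - (x *+ 2) :> R.
  by rewrite /x -mulr_natr; ring.
(* cos (2 x) = 1 forces sin x = 0, although x lies strictly between 0 and pi *)
rewrite cosN cos_mulr2n => cx.
have sx : sin x ^+ 2 = 0 by have := cos2Dsin2 x; lra.
have sx0 : 0 < sin x.
  apply: sin_gt0_pi; rewrite mulr_gt0 ?pi_gt0 ?divr_gt0 ?ltr0n//=.
  by rewrite gtr_pMr ?pi_gt0// ltr_pdivrMr// mul1r ltr_nat ltn_neqAle mN'.
by move/eqP: sx; rewrite expf_eq0 /= gt_eqF.
Qed.

(** De Moivre's formula turns the entries of the transform into powers of a
    single root of unity. *)
Lemma fourier_sliceE A (l : 'I_p.+1) :
  fourier_slice A l = fslice (real_complex R) (dft_root p.+1) A l.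
Proof.
apply: eq_bigr => k _; congr (_ *: _).
rewrite /dft_root cis_exp /dft_coef.
have -> // : - (2 * pi / p.+1%:R) * (l * k)%:R
  = - (2 * pi * (l * k)%:R / p.+1%:R) :> R by ring.
Qed.

Lemma tposdefE A : tposdef A <->
  forall l, posdefmx (fslice (real_complex R) (dft_root p.+1) A l).
Proof. by split=> Ap l; have := Ap l; rewrite fourier_sliceE. Qed.

Lemma real_complex_gt0 (a : R) : (0 < real_complex R a) = (0 < a).
Proof. exact: ltcR. Qed.

Lemma real_complex_real (a : R) : real_complex R a \is Num.real.
Proof. by apply/complex_realP; exists a. Qed.

Lemma real_complex_onto (z : R[i]) :
  z \is Num.real -> exists a, z = real_complex R a.
Proof. by move/complex_realP. Qed.

Lemma tposdef_resolution A : tposdef A ->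
  exists s P, [/\ is_resolution s P, {in s, forall a : R, 0 < a}
    & A = fcalc s P id].
Proof.
move=> /tposdefE /(spectral_resolution _ _ (dft_root_primitive _ (ltn0Sn p))
  real_complex_gt0 real_complex_onto).
by move=> [s [P [sP s0 AE _]]]; exists s, P.
Qed.

Lemma tsqrtP A : tposdef A -> is_tsqrt A (tsqrt A).
Proof.
move=> /tposdefE /(posdef_sqrt_exists _ _ (dft_root_primitive _ (ltn0Sn p))
  real_complex_gt0 real_complex_real real_complex_onto).
move=> [S Spos SS].
have St : is_tsqrt A S.
  split; last exact: SS.
  by apply/tposdefE.
rewrite /tsqrt; case: xgetP => [X _ //|/(_ S)].
by move=> /(_ St).
Qed.

End PositiveDefinite.

(** * Norm estimates *)

Section Norms.
Context {R : realType} {n p : nat}.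
Implicit Types (A : tensor R n n p.+1) (s : seq R) (P : R -> tensor R n n p.+1).

Lemma sum_sqr_le (I : finType) (x y : I -> R) :
  (forall i, 0 <= y i) -> (forall i, x i <= y i ^+ 2) ->
  \sum_i x i <= (\sum_i y i) ^+ 2.
Proof.
move=> y0 xy; rewrite expr2 mulr_suml; apply: ler_sum => i _.
apply: (le_trans (xy i)); rewrite expr2 ler_wpM2l//.
by rewrite (bigD1 i)//= lerDl sumr_ge0.
Qed.

(** The sum of the absolute values of the entries, which dominates the Frobenius
    norm and has an immediate triangle inequality. *)
Definition tnorm1 A : R := \sum_k \sum_i \sum_j `|A k i j|.

Lemma tnorm1_ge0 A : 0 <= tnorm1 A.
Proof.
by apply: sumr_ge0 => k _; apply: sumr_ge0 => i _; apply: sumr_ge0.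
Qed.

Lemma tfnorm_le_tnorm1 A : tfnorm A <= tnorm1 A.
Proof.
rewrite -[leRHS]ger0_norm ?tnorm1_ge0// -sqrtr_sqr ler_wsqrtr//.
apply: sum_sqr_le => k; first by apply: sumr_ge0 => i _; apply: sumr_ge0.
apply: sum_sqr_le => i; first exact: sumr_ge0.
by apply: sum_sqr_le => j //; rewrite real_normK ?num_real.
Qed.

Lemma tnorm1_fcalc s P (f : R -> R) :
  tnorm1 (fcalc s P f) <= \sum_(a <- s) `|f a| * tnorm1 (P a).
Proof.
elim: s => [|a s IH]; rewrite /fcalc ?big_nil ?big_cons.
  rewrite /tnorm1 big1// => k _; rewrite big1// => i _; rewrite big1// => j _.
  by rewrite ffunE mxE normr0.
apply: le_trans (lerD (lexx _) IH); rewrite /tnorm1 mulr_sumr -big_split.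
apply: ler_sum => k _; rewrite mulr_sumr -big_split; apply: ler_sum => i _.
rewrite mulr_sumr -big_split; apply: ler_sum => j _ /=.
by rewrite !ffunE !mxE -normrM ler_normD.
Qed.

Lemma tfnorm_fcalc_le s P (f c : R -> R) (e : R) :
  {in s, forall a, `|f a| <= c a * e} ->
  tfnorm (fcalc s P f) <= (\sum_(a <- s) c a * tnorm1 (P a)) * e.
Proof.
move=> fc; apply: (le_trans (tfnorm_le_tnorm1 _)).
apply: (le_trans (tnorm1_fcalc _ _ _)); rewrite mulr_suml.
rewrite big_seq [leRHS]big_seq; apply: ler_sum => a sa.
by rewrite mulrAC ler_wpM2r ?tnorm1_ge0// fc.
Qed.

Lemma cvg_fcalc s P (u : nat -> R -> R) (f : R -> R) :
  {in s, forall a, (fun m => u m a) @ \oo --> f a} ->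
  tcvg (fun m => fcalc s P (u m)) (fcalc s P f).
Proof.
move=> uf k; elim: s uf => [|a s IH] uf.
  by rewrite /fcalc; under eq_fun do rewrite big_nil; rewrite big_nil; apply: cvg_cst.
rewrite /fcalc; under eq_fun do rewrite big_cons !ffunE.
rewrite big_cons !ffunE; apply: cvgD.
  by apply: cvgZ; [apply: uf; rewrite mem_head|apply: cvg_cst].
by apply: IH => b sb; apply: uf; rewrite in_cons sb orbT.
Qed.

End Norms.

(** * The scalar iteration *)

Section Heron.
Context {R : realType}.
Implicit Types a : R.

(** Newton's iteration for the square root of a ^+ 2, started at a ^+ 2. *)
Definition heron (k : nat) (a : R) : R :=
  iter k (fun x => 2^-1 * (x + a ^+ 2 / x)) (a ^+ 2).

Arguments heron : simpl never.

Lemma heronS k a : heron k.+1 a = 2^-1 * (heron k a + a ^+ 2 / heron k a).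
Proof. by []. Qed.

Lemma heron_gt0 k a : 0 < a -> 0 < heron k a.
Proof.
move=> a0; elim: k => [|k IH]; first by rewrite exprn_gt0.
by rewrite heronS mulr_gt0 ?invr_gt0// addr_gt0// divr_gt0// exprn_gt0.
Qed.

(** From the first step on, the iterates decrease to a and the error is at least
    halved at each step, because the new error is (x - a) ^ 2 / (2 x) with x
    above a. *)
Lemma heron_error k a : 0 < a ->
  0 <= heron k.+1 a - a <= (1 + a ^+ 2) * 2^-1 ^+ k.+1.
Proof.
move=> a0; elim: k => [|k].
  rewrite /heron /= divff ?expf_neq0 ?gt_eqF// expr1.
  have := sqr_ge0 (a - 1); nra.
have := heron_gt0 k.+1 a a0.
rewrite [heron k.+2 a]heronS [2^-1 ^+ k.+2]exprS.
move: (heron k.+1 a) (2^-1 ^+ k.+1) => x e x0.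
move=> /andP[ax xle].
have -> : 2^-1 * (x + a ^+ 2 / x) - a = 2^-1 * ((x - a) * ((x - a) / x)).
  by field; rewrite gt_eqF.
have q0 : 0 <= (x - a) / x by rewrite divr_ge0// ltW.
have q1 : (x - a) / x <= 1 by rewrite ler_pdivrMr// mul1r gerBl ltW.
apply/andP; split; first by rewrite mulr_ge0 ?invr_ge0// mulr_ge0.
rewrite [leRHS]mulrCA ler_wpM2l ?invr_ge0//.
by apply: le_trans xle; rewrite ler_piMr.
Qed.

(** The bound also holds at the start, where the iterate can lie below a. *)
Lemma heron_le k a : 0 < a -> `|heron k a - a| <= (1 + a ^+ 2) * 2^-1 ^+ k.
Proof.
move=> a0; case: k => [|k]; last first.
  by have /andP[h0 h1] := heron_error k a a0; rewrite ger0_norm.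
by rewrite expr0 mulr1 /heron /= ler_norml; have := sqr_ge0 (a - 1); nra.
Qed.

Lemma cvg_heron a : 0 < a -> (fun k => heron k a) @ \oo --> a.
Proof.
move=> a0; pose e k := (1 + a ^+ 2) * 2^-1 ^+ k : R.
have e0 : e @ \oo --> 0.
  rewrite -[X in _ --> X](mulr0 (1 + a ^+ 2)); apply: cvgM; first exact: cvg_cst.
  by apply: cvg_expr; rewrite ger0_norm ?invr_ge0// invf_lt1// ltr1n.
apply: (@squeeze_cvgr _ _ _ _ (fun k => a - e k) (fun k => a + e k)).
- by apply: nearW => k; rewrite -ler_distl heron_le.
- by rewrite -[X in _ --> X]subr0; apply: cvgB => //; apply: cvg_cst.
- by rewrite -[X in _ --> X]addr0; apply: cvgD => //; apply: cvg_cst.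
Qed.

End Heron.

(** * Convergence of the iteration *)

Section DenmanBeavers.
Context {R : realType} {n p : nat} (s : seq R) (P : R -> tensor R n n p.+1).
Context (sP : is_resolution s P) (s0 : {in s, forall a : R, 0 < a}).

(** On the coefficients the iteration is Newton's: the second iterate is the first
    one divided by a ^+ 2, and this relation is preserved. *)
Lemma denman_beavers_fcalc k :
  denman_beavers (fcalc s P (fun a => a ^+ 2)) k =
  (fcalc s P (heron k), fcalc s P (fun a => heron k a / a ^+ 2)).
Proof.
elim: k => [|k /= ->].
  congr pair; rewrite -(fcalc1 _ _ sP); apply: eq_fcalc => a /s0 a0.
  by rewrite /heron divff// gt_eqF// exprn_gt0.
have Xinv : {in s, forall a, heron k a != 0}.
  by move=> a /s0 a0; rewrite gt_eqF// heron_gt0.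
have Yinv : {in s, forall a, heron k a / a ^+ 2 != 0}.
  by move=> a /s0 a0; rewrite gt_eqF// divr_gt0 ?exprn_gt0 ?heron_gt0.
rewrite (tinvE _ _ (is_tinv_fcalc _ _ _ sP Xinv)).
rewrite (tinvE _ _ (is_tinv_fcalc _ _ _ sP Yinv)) !fcalcZD.
congr pair; apply: eq_fcalc => a sa; first by rewrite invf_div.
have h0 := Xinv _ sa; have a0 : a != 0 by rewrite gt_eqF ?s0.
by field; rewrite h0 a0.
Qed.

End DenmanBeavers.

Theorem theorem2p5 (R : realType) (n p : nat) (A : tensor R n n p.+1)
    (hA : tposdef A) :
  [/\ forall k : nat, tinvertible (dbX A k) /\ tinvertible (dbY A k),
      tcvg (dbX A) (tsqrt A) /\ tcvg (dbY A) (tinv (tsqrt A))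
    & exists C r : R, [/\ 0 < C, 0 < r, r < 1 &
        \forall k \near \oo,
          tfnorm (dbX A k - tsqrt A) <= C * r ^+ k /\
          tfnorm (dbY A k - tinv (tsqrt A)) <= C * r ^+ k]].
Proof.
have [/tposdef_resolution[s [P [sP s0 SE]]] SA] := tsqrtP _ hA.
have a0 : {in s, forall a : R, a != 0} by move=> a /s0; apply: lt0r_neq0.
have SVE : tinv (tsqrt A) = fcalc s P GRing.inv.
  by rewrite SE; apply: tinvE; apply: is_tinv_fcalc.
have AE : A = fcalc s P (fun a => a ^+ 2) by rewrite -SA SE fcalcM.
have XE k : dbX A k = fcalc s P (heron k).
  by rewrite /dbX AE denman_beavers_fcalc.
have YE k : dbY A k = fcalc s P (fun a => heron k a / a ^+ 2).
  by rewrite /dbY AE denman_beavers_fcalc.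
rewrite SVE SE; split=> [k||].
- split; rewrite ?XE ?YE; eexists; apply: is_tinv_fcalc => // a /s0 b0.
    by rewrite gt_eqF// heron_gt0.
  by rewrite gt_eqF// divr_gt0 ?exprn_gt0 ?heron_gt0.
- split; [rewrite (funext XE)|rewrite (funext YE)]; apply: cvg_fcalc => a sa.
    exact/cvg_heron/s0.
  have -> : a^-1 = a / a ^+ 2 by field; exact: a0.
  by apply: cvgM; [exact/cvg_heron/s0|exact: cvg_cst].
(* the error constants on the coefficients of X and Y given by heron_le *)
- pose cX a : R := 1 + a ^+ 2; pose cY a : R := (1 + a ^+ 2) / a ^+ 2.
  pose N c : R := \sum_(a <- s) c a * tnorm1 (P a).
  have N_ge0 c : (forall a, 0 <= c a) -> 0 <= N c.
    by move=> c0; apply: sumr_ge0 => a _; rewrite mulr_ge0 ?tnorm1_ge0.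
  have cX0 a : 0 <= cX a by rewrite addr_ge0 ?sqr_ge0.
  have NX0 : 0 <= N cX by apply: N_ge0.
  have NY0 : 0 <= N cY by apply: N_ge0 => a; rewrite divr_ge0 ?sqr_ge0 ?cX0.
  exists (1 + N cX + N cY), 2^-1; split; [lra|lra|lra|].
  have h0 k : 0 <= 2^-1 ^+ k :> R by rewrite exprn_ge0// invr_ge0.
  apply: nearW => k; rewrite XE YE !fcalcB; split.
    apply: (@le_trans _ _ (N cX * 2^-1 ^+ k)); last by rewrite ler_wpM2r//; lra.
    by apply: tfnorm_fcalc_le => a /s0; apply: heron_le.
  apply: (@le_trans _ _ (N cY * 2^-1 ^+ k)); last by rewrite ler_wpM2r//; lra.
  apply: tfnorm_fcalc_le => a sa.
  have -> : heron k a / a ^+ 2 - a^-1 = (heron k a - a) / a ^+ 2.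
    by field; exact: a0.
  rewrite normrM [`|_^-1|]ger0_norm ?invr_ge0 ?sqr_ge0// /cY mulrAC.
  by rewrite ler_wpM2r ?invr_ge0 ?sqr_ge0// heron_le ?s0.
Qed.
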